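(* Suppose that for each $i\in\mathcal N=\{1,\dots,n\}$ the control function $f_i$ is non-increasing on $\mathbb R$, strictly decreasing and differentiable on $(-\infty,-\delta_i/2)\cup(\delta_i/2,+\infty)$, and that there is $\overline\alpha_i>0$ with $|f_i'(v_i)|\le\overline\alpha_i$ for all $v_i\in(-\infty,-\delta_i/2)\cup(-\delta_i/2,\delta_i/2)\cup(\delta_i/2,+\infty)$. Let $\overline A=\mathrm{diag}\{\overline\alpha_1,\dots,\overline\alpha_n\}$. If the stepsize $\gamma_3$ satisfies $$0<\gamma_3<\frac{2}{1+\lambda_{\max}(\overline A X)},$$ where $\lambda_{\max}(\overline AX)$ is the largest eigenvalue of $\overline AX$, then the dynamical system $\mathcal D_3$ $$v(t)=Xq(t)+\tilde v,\qquad q_i(t+1)=\Big[q_i(t)-\gamma_3\Big(q_i(t)-f_i\big(v_i(t)-v_i^{\mathrm{nom}}\big)\Big)\Big]_{\Omega_i},\quad i\in\mathcal N,$$ converges (from any initial $q(0)\in\Omega$) to its unique equilibrium point.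
   Context: Network: a tree with vertex set $\{0,1,\dots,n\}$ and edge set $\mathcal L$; each line $(h,k)\in\mathcal L$ has reactance $x_{hk}>0$. $\mathcal L_i\subseteq\mathcal L$ is the set of lines on the unique path from bus $0$ to bus $i$, and $X\in\mathbb R^{n\times n}$ is given by $X_{ij}=\sum_{(h,k)\in\mathcal L_i\cap\mathcal L_j}x_{hk}$ (a symmetric positive definite matrix). $\tilde v\in\mathbb R^n$ is a constant vector and $v^{\mathrm{nom}}=(1,\dots,1)^\top$. All eigenvalues of $\overline AX$ are real and positive. Feasible sets: $\Omega=\prod_{i=1}^n\Omega_i$, $\Omega_i=\{q_i: q_i^{\min}\le q_i\le q_i^{\max}\}$. For a bus with a controllable inverter, $q_i^{\max}=\min\{p_i\tan\rho_i,\sqrt{s_i^2-p_i^2}\}$ and $q_i^{\min}=-q_i^{\max}$, with constants $0\le p_i\le s_i$, $0\le\rho_i\le\pi/2$ (if $\rho_i=\pi/2$ the $\tan$ term is omitted); for a bus without one, $\Omega_i$ is a singleton. $[\cdot]_{\Omega_i}$ is the projection onto $\Omega_i$. Control functions: $f_i:\mathbb R\to\mathbb R$ is continuous, with a deadband of width $\delta_i\ge 0$ on which the control is zero: $f_i(v)=0$ for $v\in[-\delta_i/2,\delta_i/2]$. Equilibrium: $(v^*,q^* )$ is an equilibrium point of $\mathcal D_3$ if it is a fixed point, i.e. $v^*=Xq^*+\tilde v$ and $q_i^*=[q_i^*-\gamma_3(q_i^*-f_i(v_i^*-v_i^{\mathrm{nom}}))]_{\Omega_i}$ for all $i$. *)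

(* Defs.v *)
From HB Require Import structures.
From mathcomp Require Import all_boot all_order all_algebra.
From mathcomp Require Import all_classical all_reals all_analysis.
Set Implicit Arguments.
Unset Strict Implicit.
Unset Printing Implicit Defensive.
Import Order.TTheory GRing.Theory Num.Theory.
Import numFieldNormedType.Exports.
Local Open Scope ring_scope.

Section Network.
Variables (R : realType) (n : nat).

(* The vertices 0, ..., n are the elements of 'I_n.+1; a line is the unordered
   pair of its end points. *)
Notation vertex := 'I_n.+1.
Notation line := {set vertex}.

Definition adjacent (lines : {set line}) : rel vertex :=
  [rel h k | [set h; k]%SET \in lines].

Definition is_tree (lines : {set line}) : Prop :=
  [/\ forall l, l \in lines -> #|l| = 2%N,
      forall h k, connect (adjacent lines) h k
    & forall c : seq vertex, (2 < size c)%N -> ~~ ucycleb (adjacent lines) c].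

(* [h :: p] is a path from [h] to [k] without repeated vertices. *)
Definition simple_path (lines : {set line}) (h k : vertex) (p : seq vertex) :=
  [&& path (adjacent lines) h p, uniq (h :: p) & last h p == k].

Definition path_lines (h : vertex) (p : seq vertex) : seq line :=
  pairmap (fun a b => [set a; b]%SET) h p.

(* An index [i : 'I_n] stands for the bus i + 1, i.e. the vertex
   [lift ord0 i]. In a tree the path [p] below exists and is unique. *)
Definition lines_to (lines : {set line}) (i : 'I_n) : {set line} :=
  [set l | `[< exists2 p, simple_path lines ord0 (lift ord0 i) p
                        & l \in path_lines ord0 p >]]%SET.

Definition reactance_mx (lines : {set line}) (x : line -> R) : 'M[R]_n :=
  \matrix_(i, j) \sum_(l in (lines_to lines i :&: lines_to lines j)%SET) x l.

End Network.

Section Dynamics.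
Variable R : realType.

Definition is_largest_eigenvalue n (A : 'M[R]_n) (a : R) : Prop :=
  eigenvalue A a /\ forall b, eigenvalue A b -> b <= a.

(* Only real eigenvalues are considered; the default value 0 is taken when
   there is none. *)
Definition lambda_max n (A : 'M[R]_n) : R :=
  xget 0 [set a | is_largest_eigenvalue A a]%classic.

Definition q_max (p s rho : R) : R :=
  if rho == pi / 2 then Num.sqrt (s ^+ 2 - p ^+ 2)
  else Num.min (p * tan rho) (Num.sqrt (s ^+ 2 - p ^+ 2)).

(* [inv] is the set of buses with a controllable inverter; the feasible set of
   any other bus [i] is the singleton of [qfix i]. *)
Definition Omega n (inv : {set 'I_n}) (p s rho qfix : 'I_n -> R) (i : 'I_n) :
    set R :=
  if i \in inv then
    [set q | - q_max (p i) (s i) (rho i) <= q <= q_max (p i) (s i) (rho i)]%classic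
  else [set qfix i]%classic.

(* Nearest point of [S]; it exists and is unique for a nonempty closed interval
   (the default value is only there for totality). *)
Definition proj (S : set R) (x : R) : R :=
  xget x [set y | S y /\ forall z, S z -> `|x - y| <= `|x - z|]%classic.

Definition v_nom n : 'cV[R]_n := const_mx 1.

Section D3.
Variables (n : nat) (X : 'M[R]_n) (vtilde : 'cV[R]_n).
Variables (Om : 'I_n -> set R) (f : 'I_n -> R -> R) (gamma : R).

Definition D3_update (v q : 'cV[R]_n) : 'cV[R]_n :=
  \col_i proj (Om i)
    (q i 0 - gamma * (q i 0 - f i (v i 0 - v_nom n i 0))).

Definition D3_trajectory (v q : nat -> 'cV[R]_n) : Prop :=
  forall t, v t = X *m q t + vtilde /\ q t.+1 = D3_update (v t) (q t).

Definition D3_equilibrium (v q : 'cV[R]_n) : Prop :=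
  v = X *m q + vtilde /\ q = D3_update v q.

End D3.

Definition outside_deadband (d v : R) : Prop := v < - (d / 2) \/ d / 2 < v.

Definition inside_deadband (d v : R) : Prop := - (d / 2) < v < d / 2.

End Dynamics.

(* Main.v *)
(* Let [N(u) = \sum_i u_i^2 / alpha_i] and [lambda = lambda_max(A X)]. As [X] is
   positive semidefinite, [lambda] is the maximum of the Rayleigh quotient
   [u^T X u / N(u)], and each [f_i] is non-increasing and [alpha_i]-Lipschitz.

   In every case the residual [q(t+1) - q(t)] tends to 0.
   - If [gamma > 1], the unprojected update is Lipschitz for [sqrt N] with constant
     [gamma - 1 + gamma lambda < 1], and the projection on a box does not
     increase the weighted norm [sqrt N].
   - If [gamma <= 1], the update decreases the Lyapunov function
     [\sum_i C_i(q_i) + q^T X q / 2 + c^T q], where [C_i' = - f_i^-1]: as [q_i]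
     never overshoots [f_i(v_i)], strong convexity of [C_i] gives a decrease of at
     least [(1/gamma - 1/2 - lambda/2) N(q(t+1) - q(t))].

   Monotonicity of [f_i] and semidefiniteness of [X] bound the distance of two
   feasible points by their residuals, so trajectories are Cauchy, and their
   limits are one and the same fixed point. *)

Require Import Defs.
From HB Require Import structures.
From mathcomp Require Import all_boot all_order all_algebra.
From mathcomp Require Import all_classical all_reals all_analysis.
From mathcomp Require Import ring lra.
Set Implicit Arguments.
Unset Strict Implicit.
Unset Printing Implicit Defensive.
Import Order.TTheory GRing.Theory Num.Theory.
Import numFieldNormedType.Exports.
Local Open Scope ring_scope.

(** * Non-increasing Lipschitz functions and the conjugate potential of one bus *)

Section ScalarFunctions.
Context {R : realType}.
Local Open Scope classical_set_scope.
Implicit Types (f g G : R -> R) (a b u v w x y z : R).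

(** Monotonicity and the Lipschitz bound in one inequality, free of derivatives, so that kinks at
    the ends of a deadband do no harm. *)
Definition slope_bound a f := forall u v, u <= v -> 0 <= f u - f v <= a * (v - u).

Lemma slope_bound_continuous a f : slope_bound a f -> continuous f.
Proof.
move=> hf x; apply/cvgrPdist_le => e e0.
have c0 : 0 < `|a| + 1 by rewrite ltr_wpDl.
have d0 : 0 < e / (`|a| + 1) by rewrite divr_gt0.
near=> y.
have yx : `|x - y| <= e / (`|a| + 1).
  by near: y; apply: cvgr_dist_le.
rewrite ler_pdivlMr// in yx; apply: le_trans yx.
have aa := ler_norm a.
have [xy|/ltW yx] := leP x y.
  have /andP[h1 h2] := hf _ _ xy.
  by rewrite ger0_norm// distrC ger0_norm ?subr_ge0//; nra.
have /andP[h1 h2] := hf _ _ yx.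
by rewrite distrC ger0_norm// ger0_norm ?subr_ge0//; nra.
Unshelve. all: by end_near. Qed.

(** By the mean value theorem [G z - G w] is [z - w] times a value of [g] between the two points,
    which monotonicity compares with [g w]. The half-line is where the antiderivative built below is
    known to be differentiable. *)
Lemma convex_above_tangent a G g w z :
  (forall x, a < x -> is_derive x 1 G (g x)) ->
  {homo g : x y / x <= y} -> a < w -> a < z ->
  G w + g w * (z - w) <= G z.
Proof.
move=> dG gmono aw az.
have cG x y : a < x -> {within `[x, y], continuous G}.
  move=> ax; apply: derivable_within_continuous => t; rewrite in_itv/= => /andP[xt _].
  by have [] := dG t (lt_le_trans ax xt).
have [wz|zw|->] := ltgtP w z; last by rewrite subrr mulr0 addr0.
  have dwz t : t \in `]w, z[%R -> is_derive t 1 G (g t).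
    by rewrite in_itv/= => /andP[wt _]; exact: dG (lt_trans aw wt).
  have [c] := MVT wz dwz (cG _ _ aw).
  rewrite in_itv/= => /andP[/ltW wc _] e.
  by have := gmono _ _ wc; nra.
have dzw t : t \in `]z, w[%R -> is_derive t 1 G (g t).
  by rewrite in_itv/= => /andP[zt _]; exact: dG (lt_trans az zt).
have [c] := MVT zw dzw (cG _ _ az).
rewrite in_itv/= => /andP[_ /ltW cw] e.
by have := gmono _ _ cw; nra.
Qed.

Lemma antiderivative_right f a : continuous f ->
  exists G, forall x, a < x -> is_derive x 1 G (f x).
Proof.
move=> cf; exists (fun x => (\int[lebesgue_measure]_(t in `[a, x]) f t)%R) => x ax.
have xu : x < x + 1 by rewrite ltrDl.
have intf : lebesgue_measure.-integrable `[a, x + 1] (EFin \o f).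
  apply: continuous_compact_integrable; first exact: segment_compact.
  exact: continuous_subspaceT.
have [d1 d2] := continuous_FTC1_closed xu intf ax (cf x).
by apply: DeriveDef; [exact: d1|rewrite -derive1E; exact: d2].
Qed.

(* The quadratic lower bound is what makes the conjugate of [G] strongly convex. *)
Lemma antiderivative_slope_bound alpha f a G : 
  slope_bound alpha f -> (forall x, a < x -> is_derive x 1 G (f x)) ->
  forall w z, a < w -> a < z ->
    f w * (z - w) - alpha / 2 * (z - w) ^+ 2 <= G z - G w <= f w * (z - w).
Proof.
move=> hf dG w z aw az; apply/andP; split.
  have H x : a < x -> is_derive x 1 (fun y => G y + alpha / 2 * y ^+ 2) (f x + alpha * x).
    move=> /dG dGx; apply: is_derive_eq.
    rewrite /GRing.scale/=; lra.
  have := @convex_above_tangent a _ _ w z H _ aw az.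
  have m : {homo (fun x => f x + alpha * x) : x y / x <= y}.
    by move=> x y xy /=; have /andP[] := hf _ _ xy; nra.
  by move=> /(_ m); nra.
have H x : a < x -> is_derive x 1 (fun y => - G y) (- f x).
  by move=> /dG dGx; apply: is_derive_eq.
have m : {homo (fun x => - f x) : x y / x <= y}.
  by move=> x y xy /=; have /andP[] := hf _ _ xy; nra.
have := convex_above_tangent H m aw az; nra.
Qed.

Definition clamp a b x := Num.max a (Num.min b x).

(** This is [f] on [[- M, M]], continued on both sides by lines of slope [- a]: the slope bound is
    kept and the values become unbounded in both directions. *)
Definition extend_slope a f (M : R) x :=
  f (clamp (- M) M x) - a * (x - clamp (- M) M x).

Lemma slope_bound_extend a f M : 0 <= M -> 0 < a -> slope_bound a f ->
  slope_bound a (extend_slope a f M).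
Proof.
move=> M0 a0 hf u v uv; rewrite /extend_slope.
have h1 : clamp (- M) M u <= clamp (- M) M v.
  by rewrite /clamp !maxEle !minEle; repeat case: ifPn; rewrite -?ltNge; lra.
have h2 : u - clamp (- M) M u <= v - clamp (- M) M v.
  by rewrite /clamp !maxEle !minEle; repeat case: ifPn; rewrite -?ltNge; lra.
by have /andP[] := hf _ _ h1; nra.
Qed.

Lemma extend_slope_id a f M v : `|v| <= M -> extend_slope a f M v = f v.
Proof.
rewrite ler_norml => /andP[h1 h2].
have -> : extend_slope a f M v = f (clamp (- M) M v) - a * (v - clamp (- M) M v) by [].
by rewrite /clamp (min_idPr h2) (max_idPr h1) subrr mulr0 subr0.
Qed.

Lemma extend_slope_unbounded a f M B : 0 <= M -> 0 < a -> 
  exists2 L : R, 0 <= L & (forall x, x <= - L -> B < extend_slope a f M x) /\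
     (forall x, L <= x -> extend_slope a f M x < - B).
Proof.
move=> M0 a0.
(* [L] is so far out that the drop [a * (L - M)] along a linear piece exceeds
   [|B| + |f M| + |f (- M)|]. *)
pose L := M + (`|B| + `|f M| + `|f (-M)| + 1) / a.
have ML : M <= L by rewrite lerDl divr_ge0 ?ltW// ltr_wpDl.
have La : a * L = a * M + (`|B| + `|f M| + `|f (-M)| + 1).
  by rewrite /L; field; rewrite gt_eqF.
exists L; first exact: le_trans ML.
have B1 := ler_norm B; have B2 := ler_norm (f M); have B3 := ler_norm (- f (- M)).
rewrite normrN in B3.
have B4 := normr_ge0 B; have B5 := normr_ge0 (f M); have B6 := normr_ge0 (f (-M)).
split=> x hx; rewrite /extend_slope /clamp.
  rewrite min_r; last lra.
  rewrite max_l; last lra.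
  nra.
rewrite min_l; last lra.
rewrite max_r; last lra.
nra.
Qed.

(* [C] is the convex conjugate of minus an antiderivative of [f], so that
   [- C' = f^-1]; extending [f] with slope [- a] beyond [M] makes it finite
   everywhere even if [f] is bounded. *)
Lemma descent_potential a f M B : 0 <= M -> 0 < a -> slope_bound a f ->
  exists C : R -> R, exists K : R, (forall q, `|q| <= B -> K <= C q) /\
    forall v q q' gamma : R, `|v| <= M -> `|q| <= B -> `|q'| <= B -> 0 < gamma <= 1 ->
      (q <= q' /\ q' - q <= gamma * (f v - q)) \/
      (q' <= q /\ q - q' <= gamma * (q - f v)) ->
      C q' - C q + v * (q' - q) <= - (1 / a * (1 / gamma - 1 / 2) * (q' - q) ^+ 2).
Proof.
move=> M0 a0 hf.
pose g := extend_slope a f M.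
have hg : slope_bound a g := slope_bound_extend M0 a0 hf.
have cg := slope_bound_continuous hg.
have [L L0 [hL1 hL2]] := extend_slope_unbounded f B M0 a0.
have [G dG] := antiderivative_right (- L) cg.
have tG := antiderivative_slope_bound hg dG.
(* [r q] is some preimage of [q] under [g], found by the intermediate value theorem on
   [[- L, L]]. *)
have /choice [r hr] : forall q, exists w, `|q| <= B -> g w = q.
  move=> q; have [qB|_] := boolP (`|q| <= B); last by exists 0.
  have LL : - L <= L by lra.
  have := @IVT R g (- L) L q LL (continuous_subspaceT cg).
  move: qB; rewrite ler_norml => /andP[q1 q2].
  have g1 : B < g (- L) by apply: hL1.
  have g2 : g L < - B by apply: hL2.
  case=> [|w _ e]; last by exists w.
  by rewrite ge_min le_max; apply/andP; split; apply/orP; [right|left]; lra.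
have gL w : g w <= B -> - L < w.
  by move=> h; rewrite ltNge; apply/negP => /hL1; rewrite ltNge h.
have rL q : `|q| <= B -> - L < r q.
  by move=> qB; apply: gL; rewrite hr//; move: qB; rewrite ler_norml => /andP[].
pose C q := G (r q) - q * r q.
(* Fenchel-Young: [G] is concave, so its tangent of slope [q] at [r q] lies above it, and [C q] is
   the supremum of [G z - q * z] over [z > - L]. *)
have CG q z : `|q| <= B -> - L < z -> G z - q * z <= C q.
  move=> qB Lz; have /andP[_] := tG _ _ (rL _ qB) Lz.
  by rewrite hr// /C; lra.
(* The lower bound is the previous inequality at the fixed point [z = - L + 1]. *)
exists C, (G (- L + 1) - B * `| - L + 1|); split.
  move=> q qB; apply: le_trans (CG q (- L + 1) qB _); last by rewrite ltrDl.
  rewrite lerD2l lerN2; apply: le_trans (ler_norm _) _.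
  by rewrite normrM ler_wpM2r.
move=> v q q' gamma vM qB qB' /andP[ga0 ga1] hq.
have gv : g v = f v by rewrite /g extend_slope_id.
(* [f] need not be injective: when [f v = q'] the preimage [w] of [q'] must be [v]. *)
have [w [gw Lw CE wv]] : exists w,
    [/\ g w = q', - L < w, C q' = G w - q' * w & (g v = q' -> w = v)].
  have [e|ne] := eqVneq (g v) q'; last first.
    by exists (r q'); split; rewrite ?hr ?rL// => e; rewrite e eqxx in ne.
  have Lv : - L < v by apply: gL; rewrite e; move: qB'; rewrite ler_norml => /andP[].
  exists v; split=> //; apply/eqP; rewrite eq_le CG// andbT.
  have /andP[_] := tG _ _ Lv (rL _ qB').
  by rewrite e /C; lra.
(* [z] maximises [d * z - a / 2 * (z - w) ^+ 2], the lower bound of [C q - C q'] that the quadratic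
   estimate of [G] leaves; this gives the strong convexity of [C]. *)
pose d := q' - q; pose z := w + d / a.
have adz : a * (z - w) = d by rewrite /z; field; rewrite gt_eqF.
have Lz : - L < z.
  have [d0|d0] := leP 0 d; first by apply: lt_le_trans Lw _; rewrite lerDl divr_ge0// ltW.
  apply: gL; have zw : z <= w by rewrite gerDl ler_pdivrMr// mul0r ltW.
  have /andP[_ h] := hg _ _ zw.
  move: qB; rewrite ler_norml => /andP[_ qB].
  by rewrite gw in h; rewrite /d in adz; lra.
have h1 := CG q z qB Lz.
have /andP[h2 _] := tG _ _ Lw Lz.
rewrite gw in h2.
have h3 : C q' - C q <= - (d * w) - d * (z - w) / 2.
  have e : a / 2 * (z - w) ^+ 2 = d * (z - w) / 2 by rewrite -adz; field.
  by rewrite e in h2; rewrite CE /d in h1 h2 *; lra.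
(* As the step does not overshoot, [f v - q'] is at least [(1 / gamma - 1) * d] in the direction of
   [d]; the slope bound of [g] turns this difference of values into one of the arguments [w] and
   [v]. *)
have h4 : d * (v - w) <= - (1 / gamma - 1) * (d * (z - w)).
  have ig : 1 <= 1 / gamma by rewrite ler_pdivlMr// mul1r.
  set k := 1 / gamma - 1; have k0 : 0 <= k by rewrite subr_ge0.
  have kE t : k * t = t / gamma - t by rewrite /k; field; rewrite gt_eqF.
  have sgn (t : R) : 0 <= d * t -> k * d * d <= d * (a * t) -> d * (- t) <= - k * (d * (z - w)).
    move=> t0 kt; rewrite -(ler_pM2l a0) -subr_ge0.
    have -> : a * (- k * (d * (z - w))) - a * (d * - t) = d * (a * t) - k * d * (a * (z - w)) by ring.
    by rewrite adz subr_ge0.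
  rewrite -(opprB w v).
  case: hq => -[qq hd].
    have d0 : 0 <= d by rewrite /d; lra.
    have kd : k * d <= g v - g w.
      have : d / gamma <= f v - q by rewrite ler_pdivrMr// mulrC.
      by rewrite kE gv gw /d; lra.
    have vw : v <= w.
      have [//|wv'] := leP v w; have /andP[h _] := hg _ _ (ltW wv').
      have kd0 : 0 <= k * d by rewrite mulr_ge0.
      by move: wv'; rewrite wv ?ltxx// -gw; lra.
    have /andP[_ h] := hg _ _ vw.
    apply: sgn; first by rewrite mulr_ge0// subr_ge0.
    by rewrite [leLHS]mulrC ler_wpM2l//; lra.
  have d0 : 0 <= - d by rewrite /d; lra.
  have kd : k * (- d) <= g w - g v.
    have : (- d) / gamma <= q - f v by rewrite ler_pdivrMr// mulrC /d opprB.
    by rewrite kE gv gw /d; lra.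
  have vw : w <= v.
    have [//|wv'] := leP w v; have /andP[h _] := hg _ _ (ltW wv').
    have kd0 : 0 <= k * (- d) by rewrite mulr_ge0.
    by move: wv'; rewrite wv ?ltxx// -gw; lra.
  have /andP[_ h] := hg _ _ vw.
  apply: sgn; first by rewrite -mulrNN mulr_ge0// opprB subr_ge0.
  rewrite -[leRHS]mulrNN -[leLHS]mulrNN -!mulrN mulrC ler_wpM2l//; lra.
have e3 : 1 / a * (1 / gamma - 1 / 2) * (q' - q) ^+ 2 =
    (1 / gamma - 1) * (d * (z - w)) + d * (z - w) / 2.
  by rewrite /z -/d; field; rewrite !gt_eqF.
by rewrite e3 -/d; move: h3 h4; set p := d * (z - w); lra.
Qed.

End ScalarFunctions.

(** * Quadratic forms and the weighted norm *)

Section QuadraticForms.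
Context {R : realType} {n : nat}.
Implicit Types (u w : 'cV[R]_n) (X M : 'M[R]_n) (alpha : 'I_n -> R).

Definition dot u w : R := \sum_i u i 0 * w i 0.

(** A squared norm, namely the quadratic form of the inverse of [diag(alpha)]. *)
Definition wnorm alpha u : R := \sum_i u i 0 ^+ 2 / alpha i.

Definition psd X := X^T = X /\ forall u, 0 <= dot u (X *m u).

Lemma dotE u w : dot u w = (u^T *m w) 0 0.
Proof. by rewrite mxE; apply: eq_bigr => i _; rewrite mxE. Qed.

Lemma dotC u w : dot u w = dot w u.
Proof. by apply: eq_bigr => i _; rewrite mulrC. Qed.

Lemma dotDr u w w' : dot u (w + w') = dot u w + dot u w'.
Proof. by rewrite !dotE mulmxDr mxE. Qed.

Lemma dotZr a u w : dot u (a *: w) = a * dot u w.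
Proof. by rewrite !dotE -scalemxAr mxE. Qed.

Lemma dotDl u u' w : dot (u + u') w = dot u w + dot u' w.
Proof. by rewrite !(dotC _ w) dotDr. Qed.

Lemma dotZl a u w : dot (a *: u) w = a * dot u w.
Proof. by rewrite !(dotC _ w) dotZr. Qed.

Lemma dot_mulmx u w M : dot u (M *m w) = dot (M^T *m u) w.
Proof. by rewrite !dotE trmx_mul trmxK mulmxA. Qed.

Lemma dot_sym X u w : X^T = X -> dot u (X *m w) = dot w (X *m u).
Proof. by move=> sX; rewrite dot_mulmx sX dotC. Qed.

Lemma dot_expand X u w t : X^T = X ->
  dot (u + t *: w) (X *m (u + t *: w)) =
  dot u (X *m u) + 2 * t * dot w (X *m u) + t ^+ 2 * dot w (X *m w).
Proof.
move=> sX; rewrite mulmxDr -scalemxAr !dotDl !dotDr !dotZl !dotZr (dot_sym u w sX).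
ring.
Qed.

Lemma wnorm_ge0 alpha u : (forall i, 0 < alpha i) -> 0 <= wnorm alpha u.
Proof. by move=> a0; apply: sumr_ge0 => i _; rewrite divr_ge0 ?sqr_ge0// ltW. Qed.

Lemma sqr_le_wnorm alpha u i : (forall i, 0 < alpha i) ->
  u i 0 ^+ 2 <= alpha i * wnorm alpha u.
Proof.
move=> a0; rewrite mulrC -ler_pdivrMr// /wnorm (bigD1 i)//= lerDl.
by apply: sumr_ge0 => j _; rewrite divr_ge0 ?sqr_ge0// ltW.
Qed.

Lemma wnorm_eq0 alpha u : (forall i, 0 < alpha i) -> wnorm alpha u <= 0 -> u = 0.
Proof.
move=> a0 u0; apply/colP => i; rewrite mxE; apply/eqP; rewrite -sqrf_eq0 eq_le sqr_ge0 andbT.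
by apply: le_trans (sqr_le_wnorm u i a0) _; rewrite pmulr_rle0.
Qed.

Lemma wnorm_dot alpha u : wnorm alpha u = dot u (diag_mx (\row_i (alpha i)^-1) *m u).
Proof. by apply: eq_bigr => i _; rewrite mul_diag_mx !mxE expr2; ring. Qed.

Lemma dot_wnorm1 u : dot u u = wnorm (fun=> 1) u.
Proof. by apply: eq_bigr => i _; rewrite divr1 expr2. Qed.

(** Entry by entry, [|u_i u_j|] is at most [u_i^2 + u_j^2], and each square is controlled by the
    norm. The constant is crude; only its existence matters. *)
Lemma form_bounded alpha M : (forall i, 0 < alpha i) ->
  exists2 K : R, 0 < K & forall u, dot u (M *m u) <= K * wnorm alpha u.
Proof.
move=> a0.
pose K := \sum_i \sum_j `|M i j| * (alpha i + alpha j).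
have K0 : 0 <= K.
  by do 2!apply: sumr_ge0 => ? _; rewrite mulr_ge0// addr_ge0// ltW.
exists (K + 1) => [|u]; first by rewrite ltr_wpDl.
apply: (@le_trans _ _ (K * wnorm alpha u)); last first.
  by rewrite ler_wpM2r ?wnorm_ge0// lerDl.
rewrite mulr_suml; apply: ler_sum => i _; rewrite mxE mulr_sumr mulr_suml.
apply: ler_sum => j _; apply: le_trans (ler_norm _) _.
rewrite mulrCA normrM -mulrA ler_wpM2l// mulrDl.
have h1 := sqr_le_wnorm u i a0; have h2 := sqr_le_wnorm u j a0.
rewrite normrM; have := sqr_ge0 (`|u i 0| - `|u j 0|).
rewrite -real_normK ?num_real// in h1; rewrite -real_normK ?num_real// in h2.
have := sqr_ge0 `|u i 0|; have := sqr_ge0 `|u j 0|.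
nra.
Qed.

(** No diagonalisation is used. With [y = M u], invertibility bounds the norm of [u] by a multiple
    of [dot y y], and nonnegativity of the form at [u - y / K] gives [dot y y <= K * dot u y]. *)
Lemma psd_unitmx_coercive alpha M : (forall i, 0 < alpha i) -> psd M ->
  M \in unitmx -> exists2 e : R, 0 < e & forall u, e * wnorm alpha u <= dot u (M *m u).
Proof.
move=> a0 [sM pM] uM.
have [K K0 hK] := form_bounded M (fun=> ltr01).
pose N := invmx M; pose D := diag_mx (\row_i (alpha i)^-1).
have [K' K'0 hK'] := form_bounded (N^T *m D *m N) (fun=> ltr01).
exists (1 / (K * K')); first by rewrite divr_gt0// mulr_gt0.
move=> u; pose y := M *m u.
have h1 : wnorm alpha u <= K' * dot y y.
  rewrite dot_wnorm1; apply: le_trans (hK' y).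
  by rewrite -!mulmxA mulKmx// [leRHS]dot_mulmx trmxK mulKmx// -wnorm_dot.
have h2 : dot y y <= K * dot u y.
  have := pM (u + (- (1 / K)) *: y); rewrite dot_expand// -/y.
  have := hK y; rewrite -dot_wnorm1 => hy.
  have h : (- (1 / K)) ^+ 2 * dot y (M *m y) <= 1 / K * dot y y.
    have -> : 1 / K * dot y y = (- (1 / K)) ^+ 2 * (K * dot y y).
      by field; rewrite gt_eqF.
    by rewrite ler_wpM2l// sqr_ge0.
  move=> h3; rewrite mulrC -ler_pdivrMr//.
  have -> : dot y y / K = 1 / K * dot y y by field; rewrite gt_eqF.
  lra.
rewrite div1r mulrC ler_pdivrMr ?mulr_gt0//; apply: le_trans h1 _.
by rewrite mulrA [leRHS]mulrC [dot _ _ * K]mulrC ler_wpM2l// ltW.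
Qed.

(** * The Rayleigh quotient and the largest eigenvalue *)

Section Rayleigh.
Variables (alpha : 'I_n -> R) (X : 'M[R]_n).
Hypotheses (a0 : forall i, 0 < alpha i) (psdX : psd X).
Let AX := diag_mx (\row_i alpha i) *m X.

(** Eigenvectors are rows here: if [v A X = b v] with [A = diag(alpha)], then the column [u = A v^T]
    has Rayleigh quotient exactly [b]. *)
Lemma eigenvalue_le_form_bound mu b :
  (forall u, dot u (X *m u) <= mu * wnorm alpha u) -> eigenvalue AX b -> b <= mu.
Proof.
move=> hmu /eigenvalueP[v vAX v0].
pose u : 'cV[R]_n := \col_i (alpha i * v 0 i).
have uT : u^T = v *m diag_mx (\row_i alpha i).
  by apply/rowP => i; rewrite mul_mx_diag !mxE mulrC.
have e : dot u (X *m u) = b * wnorm alpha u.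
  rewrite dotE mulmxA uT -(mulmxA v) vAX -scalemxAl mxE; congr (_ * _).
  rewrite mxE; apply: eq_bigr => i _; rewrite !mxE; field; by rewrite gt_eqF.
have := hmu u; rewrite e ler_pM2r// ltNge; apply/negP => /(wnorm_eq0 a0) uz.
move/eqP : v0; apply; apply/rowP => i; have /colP/(_ i) := uz.
by rewrite !mxE => /eqP; rewrite mulf_eq0 gt_eqF//= => /eqP.
Qed.

(* [mu] is the infimum of the bounds of the Rayleigh quotient; if
   [mu A^-1 - X] were invertible, it would be coercive and [mu] not minimal. *)
Lemma rayleigh_largest_eigenvalue : (0 < n)%N ->
  exists mu : R, [/\ 0 <= mu, forall u, dot u (X *m u) <= mu * wnorm alpha u
    & is_largest_eigenvalue AX mu].
Proof.
move=> n0; have [sX pX] := psdX.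
pose E := [set r | forall u, dot u (X *m u) <= r * wnorm alpha u]%classic.
have [K K0 hK] := form_bounded X a0.
have E0 : (E !=set0)%classic by exists K.
(* One test vector of positive norm bounds [E] below by 0; this is where [n > 0] enters. *)
pose e : 'cV[R]_n := delta_mx (Ordinal n0) 0.
have we : 0 < wnorm alpha e.
  rewrite ltNge; apply/negP => /(wnorm_eq0 a0)/colP/(_ (Ordinal n0)).
  by rewrite !mxE !eqxx => /eqP; rewrite oner_eq0.
have Elb : lbound E 0.
  move=> r Er; rewrite -(pmulr_lge0 _ we); exact: le_trans (pX e) (Er e).
have hE : has_inf E by split=> //; exists 0.
pose mu := inf E.
have Emu : E mu.
  move=> u; have := wnorm_ge0 u a0; rewrite le_eqVlt => /predU1P[/esym w0|w0].
    by have := hK u; rewrite w0 !mulr0.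
  rewrite -ler_pdivrMr//; apply: lb_le_inf => // r Er.
  by rewrite ler_pdivrMr.
exists mu; split=> //; first exact: lb_le_inf.
split; last by move=> b; apply: eigenvalue_le_form_bound.
pose D := diag_mx (\row_i (alpha i)^-1).
pose M := mu *: D - X.
have ME u : dot u (M *m u) = mu * wnorm alpha u - dot u (X *m u).
  by rewrite mulmxBl -scalemxAl dotDr dotZr -wnorm_dot -scaleN1r dotZr mulN1r.
have psdM : psd M.
  split; last by move=> u; rewrite ME subr_ge0; exact: Emu.
  by rewrite /M linearB linearZ/= tr_diag_mx sX.
have [uM|] := boolP (M \in unitmx).
  have [eps eps0 heps] := psd_unitmx_coercive a0 psdM uM.
  suff : mu <= mu - eps by rewrite lerBrDl gerDr leNgt eps0.
  apply: ge_inf; first by exists 0.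
  by move=> u; have := heps u; rewrite ME; lra.
(* A row [w] with [mu w D = w X] yields the left eigenvector [w D], since [w D A X = w X]. *)
rewrite -row_free_unit -kermx_eq0 => /rowV0Pn[w /sub_kermxP wM w0].
apply/eigenvalueP; exists (w *m D).
  have DA : D *m diag_mx (\row_i alpha i) = 1%:M.
    apply/matrixP => i j; rewrite mul_diag_mx !mxE; case: eqP => [->|_].
      by rewrite mulr1n mulVf// gt_eqF.
    by rewrite mulr0n mulr0.
  rewrite /AX mulmxA -(mulmxA w) DA mulmx1 scalemxAr.
  by move/eqP : wM; rewrite mulmxBr subr_eq0 => /eqP <-.
apply: contraNneq w0 => wD; apply/eqP/rowP => i; have /rowP/(_ i) := wD.
by rewrite mul_mx_diag !mxE => /eqP; rewrite mulf_eq0 invr_eq0 (gt_eqF (a0 i)) orbF => /eqP.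
Qed.

Lemma lambda_max_form_bound : 0 <= lambda_max AX /\
  forall u, dot u (X *m u) <= lambda_max AX * wnorm alpha u.
Proof.
have [n0|] := ltnP 0 n; last first.
  rewrite leqn0 => /eqP n0; have nE i : i \in 'I_n -> False.
    by move=> _; case: i => i; rewrite n0.
  (* Without buses there is no eigenvalue and [lambda_max] takes its default value 0, which still
     bounds the zero form. *)
  have -> : lambda_max AX = 0.
    apply: xgetPN => a [/eigenvalueP[v _ /eqP v0] _]; apply: v0.
    by apply/rowP => i; case: (nE i).
  by split=> // u; rewrite mul0r /dot big1// => i; case: (nE i).
have [mu [mu0 hmu [ev le]]] := rayleigh_largest_eigenvalue n0.
suff -> : lambda_max AX = mu by [].
have [evl lel] : is_largest_eigenvalue AX (lambda_max AX) by apply: xgetPex; exists mu.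
by apply/eqP; rewrite eq_le le// lel.
Qed.

End Rayleigh.

End QuadraticForms.

(** * Semidefiniteness of the reactance matrix *)

Section Reactance.
Context {R : realType} {n : nat}.
Variables (lines : {set {set 'I_n.+1}}) (x : {set 'I_n.+1} -> R).
Hypothesis x_gt0 : forall l, l \in lines -> 0 < x l.

Lemma lines_to_subset i : lines_to lines i \subset lines.
Proof.
apply/fintype.subsetP => l; rewrite inE => /asboolP[p /and3P[+ _ _]].
elim: p (ord0 : 'I_n.+1) => [//|k p IH] h /= /andP[hk kp].
by rewrite inE => /predU1P[->|]; [exact: hk|exact: IH].
Qed.

(** Exchanging sums writes the form as the sum over the lines [l] of [x l] times the square of the
    total of [u] over the buses whose path uses [l]. *)
Lemma reactance_psd : psd (reactance_mx lines x).
Proof.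
split; first by apply/matrixP => i j; rewrite !mxE finset.setIC.
move=> u.
pose c l i := (l \in lines_to lines i)%:R * u i 0 : R.
suff -> : dot u (reactance_mx lines x *m u) =
    \sum_(l in lines) x l * (\sum_i c l i) ^+ 2.
  by apply: sumr_ge0 => l ll; rewrite mulr_ge0 ?sqr_ge0// ltW// x_gt0.
have -> : dot u (reactance_mx lines x *m u) =
    \sum_i \sum_j \sum_(l in lines) x l * (c l i * c l j).
  apply: eq_bigr => i _; rewrite mxE mulr_sumr; apply: eq_bigr => j _.
  rewrite mxE mulr_suml mulr_sumr big_mkcond [RHS]big_mkcond/=.
  apply: eq_bigr => l _; rewrite inE /c.
  have [li|li] := boolP (l \in lines_to lines i); last first.
    by rewrite /= !mul0r mulr0 if_same.
  rewrite (fintype.subsetP (lines_to_subset i) _ li) /=.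
  case: (l \in lines_to lines j) => /=; rewrite ?mul0r ?mulr0//.
  by rewrite !mul1r mulrCA.
rewrite (eq_bigr (fun i => \sum_(l in lines) x l * (c l i * \sum_j c l j))); last first.
  move=> i _; rewrite exchange_big/=; apply: eq_bigr => l _.
  by rewrite !mulr_sumr.
rewrite exchange_big/=; apply: eq_bigr => l _.
by rewrite -mulr_sumr -mulr_suml expr2.
Qed.

End Reactance.

(** * Projection on an interval, and inequalities for a single bus *)

Section ClampLemmas.
Context {R : realType}.
Implicit Types (a f lo hi q x y z e k : R).

Ltac clamp_cases := rewrite /clamp !maxEle !minEle; repeat case: ifPn; rewrite -?ltNge.

Lemma clamp_in lo hi x : lo <= hi -> lo <= clamp lo hi x <= hi.
Proof. by move=> h; rewrite /clamp le_max lexx ge_max h ge_min lexx. Qed.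

Lemma clamp_variational lo hi x z : lo <= z <= hi ->
  (x - clamp lo hi x) * (z - clamp lo hi x) <= 0.
Proof. by move=> /andP[h1 h2]; clamp_cases; nra. Qed.

(** From a feasible [q], projecting the target only shortens the move and never reverses it; this
    supplies the one-sided conditions of [descent_potential]. *)
Lemma clamp_le lo hi q x : lo <= q <= hi -> q <= x -> q <= clamp lo hi x <= x.
Proof. by move=> /andP[h1 h2] h; apply/andP; split; clamp_cases; lra. Qed.

Lemma clamp_ge lo hi q x : lo <= q <= hi -> x <= q -> x <= clamp lo hi x <= q.
Proof. by move=> /andP[h1 h2] h; apply/andP; split; clamp_cases; lra. Qed.

Lemma clamp_nonexpansive lo hi x y : lo <= hi ->
  `|clamp lo hi x - clamp lo hi y| <= `|x - y|.
Proof.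
move=> lohi; wlog xy : x y / x <= y.
  move=> wl; have [/wl//|/ltW/wl] := leP x y.
  by rewrite distrC [leRHS]distrC.
rewrite (distrC x) [X in _ <= X]ger0_norm ?subr_ge0// distrC ger0_norm ?subr_ge0.
  by clamp_cases; lra.
by clamp_cases; lra.
Qed.

(** The variational inequality gives [(x - c)^2 + (z - c)^2 <= (x - z)^2] for the clamp [c] and
    feasible [z], so [c] is a nearest point and the only one that [proj] can choose. *)
Lemma proj_clamp lo hi x : lo <= hi ->
  Defs.proj [set q | lo <= q <= hi]%classic x = clamp lo hi x.
Proof.
move=> lohi; rewrite /Defs.proj.
have c := clamp_in x lohi.
have sq (a b : R) : (`|a| <= `|b|) = (a ^+ 2 <= b ^+ 2).
  by rewrite -(@ler_pXn2r _ 2)// ?nnegrE// !real_normK ?num_real.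
have var z : lo <= z <= hi -> (x - clamp lo hi x) ^+ 2 + (z - clamp lo hi x) ^+ 2 <= (x - z) ^+ 2.
  by move=> /(clamp_variational x); nra.
have /(xgetPex x) : exists y, [set y | [set q | lo <= q <= hi]%classic y /\
    forall z, [set q | lo <= q <= hi]%classic z -> `|x - y| <= `|x - z|]%classic y.
  exists (clamp lo hi x); split=> //= z /var h; rewrite sq; apply: le_trans h.
  by rewrite lerDl sqr_ge0.
set y := xget _ _ => -[/= yin ymin].
have := ymin _ c; rewrite sq => ycl; have := var _ yin => vy.
apply/eqP; rewrite -subr_eq0 -sqrf_eq0 eq_le sqr_ge0 andbT; lra.
Qed.

(** At an exact fixed point [gamma * (q - g) * (q' - q)] is nonnegative for every feasible [q']; a
    residual of size [e] costs at most [K * e]. *)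
Lemma residual_variation lo hi gamma q q' g e K : 0 <= e ->
  lo <= q <= hi -> lo <= q' <= hi ->
  `|clamp lo hi (q - gamma * (q - g)) - q| <= e ->
  `|gamma * (q - g)| + `|q' - q| <= K ->
  - (K * e) <= gamma * (q - g) * (q' - q).
Proof.
move=> e0 hq hq' he hK.
have := clamp_variational (q - gamma * (q - g)) hq'.
set p := clamp _ _ _ in he *.
set a := gamma * (q - g) in hK *; set d := q' - q in hK *.
have -> : q - a - p = - (a + (p - q)) by ring.
have -> : q' - p = d - (p - q) by rewrite /d; ring.
set r := p - q in he *; rewrite mulNr oppr_le0 => h.
have h2 : (d - a) * r <= K * e.
  apply: le_trans (ler_norm _) _; rewrite normrM ler_pM//.
  by rewrite (le_trans (ler_normB _ _))// addrC.
have : 0 <= r ^+ 2 by rewrite sqr_ge0.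
nra.
Qed.

Lemma slope_bound_abs a (f : R -> R) x y : slope_bound a f -> `|f x - f y| <= a * `|x - y|.
Proof.
move=> hf; wlog xy : x y / x <= y.
  move=> wl; have [/wl//|/ltW/wl] := leP x y.
  by rewrite distrC [`|y - x|]distrC.
by have /andP[h1 h2] := hf _ _ xy; rewrite ger0_norm// distrC ger0_norm ?subr_ge0.
Qed.

(** If [(v' - v) * d >= 0], monotonicity makes the product with [f] nonpositive, so [|d| <= k].
    Otherwise the slope bound gives [d^2 + a * (v' - v) * d <= k^2]. Summed over the buses, the left
    side becomes the weighted norm plus the form of [X]. *)
Lemma slope_bound_monotone a (f : R -> R) (d v v' k W : R) : 0 < a -> slope_bound a f ->
  0 <= k -> `|v' - v| <= W -> d ^+ 2 <= (f v' - f v) * d + k ^+ 2 ->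
  d ^+ 2 / a + (v' - v) * d <= k ^+ 2 / a + W * k.
Proof.
move=> a0 hf k0 hW hd.
have W0 : 0 <= W := le_trans (normr_ge0 _) hW.
have Wk : 0 <= W * k by rewrite mulr_ge0.
have [vd|vd] := leP 0 ((v' - v) * d).
  have fd : (f v' - f v) * d <= 0.
    have [vv|/ltW vv] := leP v v'; have /andP[h _] := hf _ _ vv.
      have [->|vn] := eqVneq v v'; first by rewrite subrr mul0r.
      have vv' : 0 < v' - v by rewrite subr_gt0 lt_neqAle vn.
      by rewrite pmulr_rge0// in vd; nra.
    have [->|vn] := eqVneq v v'; first by rewrite subrr mul0r.
    have vv' : v' - v < 0 by rewrite subr_lt0 lt_neqAle eq_sym vn.
    by rewrite nmulr_rge0// in vd; nra.
  have dk2 : d ^+ 2 <= k ^+ 2 by lra.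
  have dk : `|d| <= k.
    by rewrite -(@ler_pXn2r _ 2)// ?nnegrE// real_normK// num_real.
  apply: lerD; first by rewrite ler_pM2r ?invr_gt0.
  by apply: le_trans (ler_norm _) _; rewrite normrM ler_pM.
have h : (f v' - f v) * d <= - (a * ((v' - v) * d)).
  have [vv|/ltW vv] := leP v v'; have /andP[h1 h2] := hf _ _ vv.
    have : d < 0 by rewrite ltNge; apply/negP => d0; move: vd; rewrite ltNge mulr_ge0// subr_ge0.
    by nra.
  have : 0 < d by rewrite ltNge; apply/negP => d0; move: vd; rewrite ltNge -mulrNN mulr_ge0// ?opprB ?subr_ge0// oppr_ge0.
  by nra.
have -> : (v' - v) * d = a * ((v' - v) * d) / a by field; rewrite gt_eqF.
rewrite -mulrDl.
apply: (@le_trans _ _ (k ^+ 2 / a)); last by rewrite lerDl.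
rewrite ler_pM2r ?invr_gt0//; lra.
Qed.

End ClampLemmas.

(** * Estimates for one step of the projected iteration *)

Section ProjectedIteration.
Context {R : realType} {n : nat}.
Variables (alpha lo hi : 'I_n -> R) (X : 'M[R]_n) (c : 'cV[R]_n).
Variables (f : 'I_n -> R -> R) (gamma lam : R).
Hypotheses (a0 : forall i, 0 < alpha i) (psdX : psd X).
Hypothesis lohi : forall i, lo i <= hi i.
Hypothesis slope_f : forall i, slope_bound (alpha i) (f i).
Hypothesis lam0 : 0 < lam.
Hypothesis form_lam : forall u, dot u (X *m u) <= lam * wnorm alpha u.
Hypotheses (gamma0 : 0 < gamma) (gamma_lam : gamma * (1 + lam) < 2).

Let volt (q : 'cV[R]_n) : 'cV[R]_n := X *m q + c.

Definition feasible (q : 'cV[R]_n) := forall i, lo i <= q i 0 <= hi i.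

Definition step (q : 'cV[R]_n) : 'cV[R]_n :=
  \col_i clamp (lo i) (hi i) (q i 0 - gamma * (q i 0 - f i (volt q i 0))).

Lemma stepE q i :
  step q i 0 = clamp (lo i) (hi i) (q i 0 - gamma * (q i 0 - f i (volt q i 0))).
Proof. by rewrite mxE. Qed.

Lemma feasible_step q : feasible (step q).
Proof. by move=> i; rewrite mxE clamp_in. Qed.

Lemma voltB q q' : volt q' - volt q = X *m (q' - q).
Proof. by rewrite /volt mulmxBr opprD addrACA subrr addr0. Qed.

Lemma finite_bound (F : 'I_n -> R) : exists2 K : R, 0 <= K & forall i, F i <= K.
Proof.
exists (\sum_i `|F i|) => [|i]; first exact: sumr_ge0.
by rewrite (bigD1 i)//= ler_wpDr ?sumr_ge0// ler_norm.
Qed.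

Lemma feasible_bounded : exists2 B : R, 0 <= B & forall q, feasible q -> forall i,
  [/\ `|q i 0| <= B, `|volt q i 0| <= B & `|f i (volt q i 0)| <= B].
Proof.
have [B1 B10 hB1] := finite_bound (fun i => `|lo i| + `|hi i|).
have [B2 B20 hB2] := finite_bound (fun i => \sum_j `|X i j| * B1 + `|c i 0|).
have [B3 B30 hB3] := finite_bound (fun i => alpha i * B2 + `|f i 0|).
exists (B1 + B2 + B3) => [|q fq]; first by rewrite !addr_ge0.
have q1 i : `|q i 0| <= B1.
  apply: le_trans (hB1 i); have /andP[h1 h2] := fq i.
  have := ler_norm (hi i); have := ler_norm (- lo i); rewrite normrN ler_norml.
  have := normr_ge0 (hi i); have := normr_ge0 (lo i).
  by move=> *; apply/andP; split; lra.
have q2 i : `|volt q i 0| <= B2.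
  apply: le_trans (hB2 i); rewrite mxE; apply: le_trans (ler_normD _ _) _.
  rewrite lerD2r mxE; apply: le_trans (ler_norm_sum _ _ _) _.
  by apply: ler_sum => j _; rewrite normrM ler_wpM2l.
move=> i; split.
- by apply: le_trans (q1 i) _; rewrite -addrA lerDl addr_ge0.
- by apply: le_trans (q2 i) _; rewrite addrAC lerDr addr_ge0.
apply: (@le_trans _ _ B3); last by rewrite lerDr addr_ge0.
apply: le_trans (hB3 i); rewrite -[X in `|X|](subrK (f i 0)).
apply: le_trans (ler_normD _ _) _; rewrite lerD2r.
apply: le_trans (slope_bound_abs _ _ (slope_f i)) _.
by rewrite subr0 ler_wpM2l ?q2// ltW.
Qed.

(** The left side is the squared norm of [y = A X d] with [A = diag(alpha)], so [A X] has operator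
    norm at most [lam]. The proof tests semidefiniteness at [y - lam d]. *)
Lemma image_form_bound d :
  \sum_i alpha i * (X *m d) i 0 ^+ 2 <= lam ^+ 2 * wnorm alpha d.
Proof.
have [sX pX] := psdX; set S := \sum_i _.
pose y : 'cV[R]_n := \col_i (alpha i * (X *m d) i 0).
have yS : dot y (X *m d) = S.
  by apply: eq_bigr => i _; rewrite mxE expr2 mulrA.
have wS : wnorm alpha y = S.
  by apply: eq_bigr => i _; rewrite mxE; field; rewrite gt_eqF.
have := pX (y + (- lam) *: d); rewrite dot_expand// (dot_sym d y sX) yS => h.
have := form_lam y; rewrite wS => h1.
have := form_lam d => h2.
have h3 : (- lam) ^+ 2 * dot d (X *m d) <= lam * (lam ^+ 2 * wnorm alpha d).
  have -> : lam * (lam ^+ 2 * wnorm alpha d) = (- lam) ^+ 2 * (lam * wnorm alpha d) by ring.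
  by rewrite ler_wpM2l ?sqr_ge0.
by rewrite -(ler_pM2l lam0); lra.
Qed.

(** For [gamma > 1] this is the contraction; for smaller [gamma] it still provides the continuity of
    [step]. *)
Lemma step_lipschitz q q' : wnorm alpha (step q' - step q) <=
  (`|1 - gamma| + gamma * lam) ^+ 2 * wnorm alpha (q' - q).
Proof.
set d := q' - q; set g := `|1 - gamma|; pose w := X *m d.
have g0 : 0 <= g := normr_ge0 _.
(* The cross term is split by [2 A (alpha B) <= lam A^2 + (alpha B)^2 / lam]; with these weights the
   sum over the buses gives exactly the square [(g + gamma lam)^2]. *)
have h i : (step q' - step q) i 0 ^+ 2 / alpha i <=
    (g ^+ 2 + g * gamma * lam) * (d i 0 ^+ 2 / alpha i) +
    (gamma ^+ 2 + g * gamma / lam) * (alpha i * w i 0 ^+ 2).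
  have ai := a0 i; set e := (step q' - step q) i 0.
  have he : `|e| <= g * `|d i 0| + gamma * (alpha i * `|w i 0|).
    rewrite /e mxE [X in _ + X]mxE !stepE.
    apply: le_trans (clamp_nonexpansive _ _ (lohi i)) _.
    have -> : q' i 0 - gamma * (q' i 0 - f i (volt q' i 0)) -
        (q i 0 - gamma * (q i 0 - f i (volt q i 0))) =
        (1 - gamma) * d i 0 + gamma * (f i (volt q' i 0) - f i (volt q i 0)).
      by rewrite /d !mxE; ring.
    apply: le_trans (ler_normD _ _) _.
    rewrite !normrM lerD2l (gtr0_norm gamma0) ler_pM2l//.
    apply: le_trans (slope_bound_abs _ _ (slope_f i)) _.
    rewrite ler_pM2l// /w -voltB !mxE lexx//.
  set A := `|d i 0| in he *; set B := `|w i 0| in he *.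
  have -> : d i 0 ^+ 2 = A ^+ 2 by rewrite real_normK// num_real.
  have -> : w i 0 ^+ 2 = B ^+ 2 by rewrite real_normK// num_real.
  have A0 : 0 <= A := normr_ge0 _; have B0 : 0 <= B := normr_ge0 _.
  have e2 : e ^+ 2 <= (g * A + gamma * (alpha i * B)) ^+ 2.
    rewrite -[e ^+ 2]real_normK ?num_real// ler_pXn2r// ?nnegrE//.
    have aB0 : 0 <= alpha i * B by rewrite mulr_ge0// ltW.
    by rewrite addr_ge0// mulr_ge0// ltW.
  apply: (@le_trans _ _ ((g * A + gamma * (alpha i * B)) ^+ 2 / alpha i)).
    by rewrite ler_pM2r ?invr_gt0.
  rewrite -subr_ge0.
  have -> : (g ^+ 2 + g * gamma * lam) * (A ^+ 2 / alpha i) +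
    (gamma ^+ 2 + g * gamma / lam) * (alpha i * B ^+ 2) -
    (g * A + gamma * (alpha i * B)) ^+ 2 / alpha i =
    g * gamma * (lam * A - alpha i * B) ^+ 2 / (lam * alpha i).
    by field; rewrite !gt_eqF.
  have gg0 : 0 <= g * gamma by rewrite mulr_ge0// ltW.
  by apply: divr_ge0; apply: mulr_ge0; rewrite ?sqr_ge0// ltW.
apply: le_trans (ler_sum _ (fun i _ => h i)) _.
rewrite big_split/= -!mulr_sumr -/(wnorm alpha d).
have -> : (g + gamma * lam) ^+ 2 * wnorm alpha d =
  (g ^+ 2 + g * gamma * lam) * wnorm alpha d +
  (gamma ^+ 2 + g * gamma / lam) * (lam ^+ 2 * wnorm alpha d).
  by field; rewrite gt_eqF.
rewrite lerD2l ler_wpM2l ?image_form_bound//.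
have gg0 : 0 <= g * gamma by rewrite mulr_ge0// ltW.
by rewrite addr_ge0 ?sqr_ge0// divr_ge0// ltW.
Qed.

Lemma step_descent : gamma <= 1 ->
  exists V : 'cV[R]_n -> R, exists K : R, (forall q, feasible q -> K <= V q) /\
  exists2 kappa : R, 0 < kappa & forall q, feasible q ->
    V (step q) <= V q - kappa * wnorm alpha (step q - q).
Proof.
move=> gamma1; have [sX pX] := psdX; have [B B0 hB] := feasible_bounded.
have /choice[C /choice[K hC]] := fun i => descent_potential B B0 (a0 i) (slope_f i).
exists (fun q : 'cV[R]_n => \sum_i C i (q i 0) + dot q (X *m q) / 2 + dot c q).
exists (\sum_i K i - \sum_i `|c i 0| * B); split.
  move=> q fq; rewrite -addrA lerD//.
    by apply: ler_sum => i _; apply: (hC i).1; have [] := hB _ fq i.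
  rewrite -[leLHS]add0r lerD//; first by rewrite divr_ge0.
  rewrite -sumrN; apply: ler_sum => i _.
  rewrite lerNl; apply: le_trans (ler_norm _) _.
  by rewrite normrN normrM ler_wpM2l//; have [] := hB _ fq i.
pose kappa := 1 / gamma - 1 / 2 - lam / 2.
exists kappa.
  have -> : kappa = (2 - gamma * (1 + lam)) / (2 * gamma).
    by rewrite /kappa; field; rewrite gt_eqF.
  by rewrite divr_gt0 ?subr_gt0// mulr_gt0.
move=> q fq; set q' := step q; set d := q' - q.
have fq' : feasible q' := feasible_step q.
(* The expansion is exact: the gradient of the quadratic part is [volt q], which matches the term
   [v * (q' - q)] of [descent_potential], and the remainder is at most [lam / 2] times the norm of
   [d]. *)
have e1 : dot q' (X *m q') / 2 + dot c q' =
   dot q (X *m q) / 2 + dot c q + dot (volt q) d + dot d (X *m d) / 2.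
  have -> : q' = q + 1 *: d by rewrite scale1r addrC subrK.
  rewrite dot_expand// dotDr dotZr /volt (dotDl (X *m q)) (dotC (X *m q)).
  by field.
have e2 : \sum_i C i (q' i 0) + dot (volt q) d <=
    \sum_i C i (q i 0) - (1 / gamma - 1 / 2) * wnorm alpha d.
  rewrite mulr_sumr -sumrB -big_split/=; apply: ler_sum => i _.
  have [qB vB _] := hB _ fq i; have [q'B _ _] := hB _ fq' i.
  have g01 : 0 < gamma <= 1 by rewrite gamma0.
  have [] := hC i => _ /(_ (volt q i 0) (q i 0) (q' i 0) gamma vB qB q'B g01).
  have dE : d i 0 = q' i 0 - q i 0 by rewrite !mxE.
  rewrite dE => H.
  have {H} : C i (q' i 0) - C i (q i 0) + volt q i 0 * (q' i 0 - q i 0) <=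
    - (1 / alpha i * (1 / gamma - 1 / 2) * (q' i 0 - q i 0) ^+ 2).
    apply: H; rewrite stepE.
    have [h|/ltW h] := leP (q i 0) (f i (volt q i 0)); [left|right].
      have p0 : 0 <= gamma * (f i (volt q i 0) - q i 0) by rewrite mulr_ge0 ?subr_ge0// ltW.
      have [|h1 h2] := andP (@clamp_le _ _ _ _ (q i 0 - gamma * (q i 0 - f i (volt q i 0))) (fq i) _); lra.
    have p0 : 0 <= gamma * (q i 0 - f i (volt q i 0)) by rewrite mulr_ge0 ?subr_ge0// ltW.
    have [|h1 h2] := andP (@clamp_ge _ _ _ _ (q i 0 - gamma * (q i 0 - f i (volt q i 0))) (fq i) _); lra.
  have -> : 1 / alpha i * (1 / gamma - 1 / 2) * (q' i 0 - q i 0) ^+ 2 =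
    (1 / gamma - 1 / 2) * ((q' i 0 - q i 0) ^+ 2 / alpha i) by field; rewrite !gt_eqF.
  lra.
have h := form_lam d; rewrite /kappa.
move: e1 e2 h; set V1 := dot q' _ / 2; set V2 := dot c q'; lra.
Qed.

(** The two approximate variational inequalities, each tested at the other point, are added.
    Residuals are measured by [eps ^+ 2] since an error linear in the residual controls the square
    of the distance. *)
Lemma residual_error_bound : exists2 K : R, 0 <= K & forall (eps : R) (q q' : 'cV[R]_n), 0 <= eps ->
  feasible q -> feasible q' ->
  (forall i, `|step q i 0 - q i 0| <= eps ^+ 2) ->
  (forall i, `|step q' i 0 - q' i 0| <= eps ^+ 2) ->
  wnorm alpha (q' - q) <= K * (eps ^+ 2 + eps).
Proof.
have [sX pX] := psdX; have [B B0 hB] := feasible_bounded.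
pose K1 := gamma * (B + B) + (B + B).
(* Chosen so that [2 * K1 <= gamma * k ^+ 2]: the error of the added inequalities then fits into
   [(k * eps) ^+ 2]. *)
pose k := 2 * K1 / gamma + 1.
have BB0 : 0 <= B + B by rewrite addr_ge0.
have K10 : 0 <= K1 by rewrite addr_ge0// mulr_ge0// ltW.
have k1 : 1 <= k by rewrite lerDr divr_ge0 ?(ltW gamma0)// mulr_ge0.
have k0 : 0 <= k by lra.
have kK : 2 * K1 <= gamma * k ^+ 2.
  have -> : 2 * K1 = gamma * (k - 1) by rewrite /k; field; rewrite gt_eqF.
  by rewrite ler_pM2l//; nra.
pose K := \sum_i (k ^+ 2 / alpha i + (B + B) * k).
have K0 i : 0 <= k ^+ 2 / alpha i + (B + B) * k.
  by rewrite addr_ge0// ?mulr_ge0 ?sqr_ge0// invr_ge0 ltW.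
exists K => [|eps q q' eps0 fq fq' rq rq']; first exact: sumr_ge0.
set d := q' - q.
(* Adding the nonnegative form of [X] allows a comparison bus by bus through
   [slope_bound_monotone]. *)
apply: (@le_trans _ _ (wnorm alpha d + dot d (X *m d))); first by rewrite lerDl.
rewrite mulr_suml -big_split/=; apply: ler_sum => i _.
have [q1 q2 q3] := hB _ fq i; have [q'1 q'2 q'3] := hB _ fq' i.
have := rq i; have := rq' i; rewrite !stepE => r' r.
have e20 : 0 <= eps ^+ 2 by rewrite sqr_ge0.
have bd (x1 x2 y : R) : `|x1| <= B -> `|x2| <= B -> `|y| <= B ->
    `|gamma * (x1 - y)| + `|x2 - x1| <= K1.
  move=> b1 b2 b3; rewrite normrM gtr0_norm// lerD// ?ler_pM2l//.
    by rewrite (le_trans (ler_normB _ _))// lerD.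
  by rewrite (le_trans (ler_normB _ _))// lerD.
have v1 := residual_variation e20 (fq i) (fq' i) r (bd _ _ _ q1 q'1 q3).
have v2 := residual_variation e20 (fq' i) (fq i) r' (bd _ _ _ q'1 q1 q'3).
have dE : d i 0 = q' i 0 - q i 0 by rewrite !mxE.
have wE : (X *m d) i 0 = volt q' i 0 - volt q i 0 by rewrite -voltB !mxE.
have hd : d i 0 ^+ 2 <= (f i (volt q' i 0) - f i (volt q i 0)) * d i 0 + (k * eps) ^+ 2.
  rewrite -(ler_pM2l gamma0) dE exprMn.
  have : 2 * K1 * eps ^+ 2 <= gamma * k ^+ 2 * eps ^+ 2 by rewrite ler_wpM2r.
  nra.
have hw : `|volt q' i 0 - volt q i 0| <= B + B.
  by rewrite (le_trans (ler_normB _ _))// lerD.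
have := slope_bound_monotone (a0 i) (slope_f i) (mulr_ge0 k0 eps0) hw hd.
rewrite wE [d i 0 * _]mulrC => h; apply: le_trans h _.
have t1 : 0 <= k ^+ 2 / alpha i by rewrite divr_ge0 ?sqr_ge0// ltW.
have t2 : 0 <= (B + B) * k by rewrite mulr_ge0// addr_ge0.
rewrite exprMn mulrAC [_ * (k * eps)]mulrA; nra.
Qed.

End ProjectedIteration.

(** * The weighted norm and the topology of column vectors *)

Section Convergence.
Context {R : realType} {n : nat}.
Local Open Scope classical_set_scope.

Section WeightedNormTopology.
Variable alpha : 'I_n -> R.
Hypothesis a0 : forall i, 0 < alpha i.
Implicit Types (u : nat -> 'cV[R]_n) (l : 'cV[R]_n).

Lemma wnorm_sub_le : exists2 A, 0 < A &
  forall (d : 'cV[R]_n) i, d i 0 ^+ 2 <= A * wnorm alpha d.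
Proof.
have [A A0 hA] := finite_bound alpha.
exists (A + 1) => [|d i]; first by rewrite ltr_wpDl.
apply: le_trans (sqr_le_wnorm d i a0) _; rewrite ler_wpM2r ?wnorm_ge0//.
by apply: le_trans (hA i) _; rewrite lerDl.
Qed.

Lemma wnorm_lt_ball (e : R) : 0 < e -> exists2 r, 0 < r &
  forall l l' : 'cV[R]_n, wnorm alpha (l' - l) < r -> ball l e l'.
Proof.
move=> e0; have [A A0 hA] := wnorm_sub_le.
exists (e ^+ 2 / A) => [|l l' h]; first by rewrite divr_gt0 ?exprn_gt0.
split=> // i j; rewrite ord1 /ball/= distrC.
rewrite -(@ltr_pXn2r _ 2)// ?nnegrE// ?ltW// real_normK ?num_real//.
have -> : l' i 0 - l i 0 = (l' - l) i 0 by rewrite !mxE.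
by apply: le_lt_trans (hA _ i) _; rewrite mulrC -ltr_pdivlMr.
Qed.

Lemma wnorm_cvg u l : wnorm alpha (u t - l) @[t --> \oo] --> (0 : R) ->
  u @ \oo --> l.
Proof.
move=> h; apply/cvg_ballP => e e0; have [r r0 hr] := wnorm_lt_ball e0.
near=> t; apply: hr; near: t.
by apply: cvgr_lt h _ r0.
Unshelve. all: by end_near. Qed.

Lemma cvg_wnorm u l : u @ \oo --> l -> wnorm alpha (u t - l) @[t --> \oo] --> (0 : R).
Proof.
move=> /cvg_ballP h; apply/cvgrPdist_le => e e0.
have [S S0 hS] : exists2 S : R, 0 <= S & \sum_i (alpha i)^-1 <= S.
  by exists (\sum_i (alpha i)^-1) => //; apply: sumr_ge0 => i _; rewrite invr_ge0 ltW.
(* As [d <= 1], one has [d ^+ 2 * S <= d * (S + 1) <= e]. *)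
pose d := Num.min 1 (e / (S + 1)).
have S1 : 0 < S + 1 by rewrite ltr_wpDl.
have d0 : 0 < d by rewrite lt_min ltr01 divr_gt0.
have d1 : d <= 1 by rewrite ge_min lexx.
have dS : d * (S + 1) <= e by rewrite -ler_pdivlMr// ge_min lexx orbT.
near=> t; rewrite sub0r normrN ger0_norm ?wnorm_ge0//.
have [_ b] : ball l d (u t) by near: t; exact: h.
apply: (@le_trans _ _ (d ^+ 2 * S)); last by nra.
apply: (@le_trans _ _ (d ^+ 2 * \sum_i (alpha i)^-1)); last first.
  by rewrite ler_wpM2l// sqr_ge0.
rewrite mulr_sumr; apply: ler_sum => i _; rewrite ler_pM2r ?invr_gt0//.
have := b i 0; rewrite /ball/= distrC => /ltW bi.
rewrite -[leLHS]real_normK ?num_real// ler_pXn2r ?nnegrE ?(ltW d0)//.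
by rewrite !mxE.
Unshelve. all: by end_near. Qed.

Lemma wnorm_cauchy_cvg u :
  (forall e : R, 0 < e -> exists N, forall t, (N <= t)%N -> wnorm alpha (u t - u N) < e) ->
  exists l : 'cV[R]_n, u @ \oo --> l.
Proof.
move=> h; suff : cvg (u @ \oo) by move=> /cvg_ex.
apply: cauchy_cvg; apply: cauchy_exP => e e0.
have [r r0 hr] := wnorm_lt_ball e0; have [N hN] := h r r0.
by exists (u N), N => // t /= Nt; apply: hr; exact: hN.
Qed.

End WeightedNormTopology.

(** * Convergence of the iteration to its unique fixed point *)

Section FixedPoint.
Variables (alpha lo hi : 'I_n -> R) (X : 'M[R]_n) (c : 'cV[R]_n).
Variables (f : 'I_n -> R -> R) (gamma lam : R).
Hypotheses (a0 : forall i, 0 < alpha i) (psdX : psd X).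
Hypothesis lohi : forall i, lo i <= hi i.
Hypothesis slope_f : forall i, slope_bound (alpha i) (f i).
Hypothesis lam0 : 0 < lam.
Hypothesis form_lam : forall u, dot u (X *m u) <= lam * wnorm alpha u.
Hypotheses (gamma0 : 0 < gamma) (gamma_lam : gamma * (1 + lam) < 2).
Let step := step lo hi X c f gamma.
Let feasible := feasible lo hi.

Lemma residual_cvg (q : nat -> 'cV[R]_n) : feasible (q 0%N) ->
  (forall t, q t.+1 = step (q t)) ->
  wnorm alpha (q t.+1 - q t) @[t --> \oo] --> (0 : R).
Proof.
move=> q0 qS.
have fq t : feasible (q t) by case: t => // t; rewrite qS; exact: feasible_step.
have r0 t : 0 <= wnorm alpha (q t.+1 - q t) by rewrite wnorm_ge0.
have [g1|g1] := leP gamma 1.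
  have [V [K [VK [kappa k0 hV]]]] :=
    step_descent c a0 psdX lohi slope_f form_lam gamma0 gamma_lam g1.
  pose v t := V (q t).
  have hv t : kappa * wnorm alpha (q t.+1 - q t) <= v t - v t.+1.
    by have := hV _ (fq t); rewrite -/step -qS -/(v t) -/(v t.+1); lra.
  (* The potential decreases and is bounded below along the trajectory, so its successive
     differences, which dominate the residuals, tend to 0. *)
  have cv : cvgn v.
    apply: nonincreasing_is_cvgn.
      apply/nonincreasing_seqP => t; rewrite -subr_ge0; apply: le_trans (hv t).
      by rewrite mulr_ge0// ltW.
    by exists K => _ [t _ <-]; exact: VK (fq t).
  have dv : (v t - v t.+1) / kappa @[t --> \oo] --> (0 : R).
    rewrite -[X in _ --> X](mul0r kappa^-1); apply: cvgM; last exact: cvg_cst.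
    rewrite -[X in _ --> X](subrr (limn v)); apply: cvgB => //.
    by rewrite cvg_shiftS.
  apply: (squeeze_cvgr _ (cvg_cst 0) dv); near=> t; rewrite r0/=.
  by rewrite ler_pdivlMr// mulrC.
(* Here [gamma > 1], and [gamma - 1 + gamma * lam < 1] is the stepsize condition; the residuals
   decay geometrically. *)
pose rho := (`|1 - gamma| + gamma * lam) ^+ 2.
have ge : `|1 - gamma| = gamma - 1 by rewrite distrC gtr0_norm// subr_gt0.
have rho1 : `|rho| < 1.
  have gl : 0 < gamma * lam by rewrite mulr_gt0.
  have gl2 : gamma + gamma * lam < 2 by move: gamma_lam; rewrite mulrDr mulr1.
  rewrite ger0_norm ?sqr_ge0// /rho ge expr_lt1//; lra.
have rt t : wnorm alpha (q t.+1 - q t) <= rho ^+ t * wnorm alpha (q 1%N - q 0%N).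
  elim: t => [|t IH]; first by rewrite expr0 mul1r.
  rewrite exprS -mulrA; apply: le_trans (ler_wpM2l (sqr_ge0 _) IH).
  rewrite (qS t.+1) [q t.+1 in X in _ - X]qS; exact: step_lipschitz.
have gt0 : rho ^+ t * wnorm alpha (q 1%N - q 0%N) @[t --> \oo] --> (0 : R).
  rewrite -[X in _ --> X](mul0r (wnorm alpha (q 1%N - q 0%N))); apply: cvgM; last exact: cvg_cst.
  exact: cvg_expr.
by apply: (squeeze_cvgr _ (cvg_cst 0) gt0); near=> t; rewrite r0/=.
Unshelve. all: by end_near. Qed.

Lemma step_trajectory_cvg (q : nat -> 'cV[R]_n) : feasible (q 0%N) ->
  (forall t, q t.+1 = step (q t)) ->
  exists2 l, step l = l & q @ \oo --> l.
Proof.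
move=> q0 qS; have rq := residual_cvg q0 qS.
have fq t : feasible (q t) by case: t => // t; rewrite qS; exact: feasible_step.
have [K K0 hK] := residual_error_bound lo hi c a0 psdX slope_f gamma0.
have [A A0 hA] := wnorm_sub_le a0.
have [l ql] : exists l : 'cV[R]_n, q @ \oo --> l.
  apply: (wnorm_cauchy_cvg a0) => e e0.
  (* [d] plays the role of [eps] in the error bound: [K * (d ^+ 2 + d) <= 2 * K * d < e]. *)
  pose d := Num.min 1 (e / (2 * K + 1)).
  have S1 : 0 < 2 * K + 1 by lra.
  have d0 : 0 < d by rewrite lt_min ltr01 divr_gt0.
  have d1 : d <= 1 by rewrite ge_min lexx.
  have dS : d * (2 * K + 1) <= e by rewrite -ler_pdivlMr// ge_min lexx orbT.
  (* The threshold is [d ^+ 4 / A] because the error bound asks for coordinate residuals of size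
     [d ^+ 2], whose squares are at most [A] times the norm. *)
  have [N _ hN] : \forall t \near \oo, wnorm alpha (q t.+1 - q t) < d ^+ 4 / A.
    by apply: cvgr_lt rq _ _; rewrite divr_gt0 ?exprn_gt0.
  have res t : (N <= t)%N -> forall i, `|step (q t) i 0 - q t i 0| <= d ^+ 2.
    move=> /hN /= h i; rewrite -(@ler_pXn2r _ 2)// ?nnegrE ?sqr_ge0//.
    rewrite real_normK ?num_real// -exprM -qS.
    have -> : q t.+1 i 0 - q t i 0 = (q t.+1 - q t) i 0 by rewrite !mxE.
    by apply: le_trans (hA _ i) _; rewrite mulrC -ler_pdivlMr// ltW.
  exists N => t Nt.
  apply: le_lt_trans (hK d _ _ (ltW d0) (fq N) (fq t) (res N _) (res t Nt)) _ => //.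
  have : K * (d ^+ 2 + d) <= K * (2 * d) by rewrite ler_wpM2l//; nra.
  nra.
exists l => //.
(* The shifted trajectory tends to [step l] by the Lipschitz estimate and to [l] as a shift;
   uniqueness of limits makes [l] a fixed point. *)
have qSl : (fun t => q t.+1) @ \oo --> step l.
  apply: (wnorm_cvg a0).
  pose rho := (`|1 - gamma| + gamma * lam) ^+ 2.
  have h : rho * wnorm alpha (q t - l) @[t --> \oo] --> (0 : R).
    rewrite -[X in _ --> X](mulr0 rho); apply: cvgM; [exact: cvg_cst|exact: cvg_wnorm].
  apply: (squeeze_cvgr _ (cvg_cst 0) h); near=> t; rewrite wnorm_ge0//= qS.
  exact: step_lipschitz.
have ql1 : (fun t => q t.+1) @ \oo --> l by rewrite cvg_shiftS.
exact: (cvg_unique (@norm_hausdorff _ 'cV[R]_n) qSl ql1).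
Unshelve. all: by end_near. Qed.

(** This is the error bound with [eps = 0]. *)
Lemma step_fixpoint_unique q q' : step q = q -> step q' = q' -> q = q'.
Proof.
move=> eq eq'.
have [K K0 hK] := residual_error_bound lo hi c a0 psdX slope_f gamma0.
have fq : feasible q by rewrite -eq; exact: feasible_step.
have fq' : feasible q' by rewrite -eq'; exact: feasible_step.
apply/esym/eqP; rewrite -subr_eq0; apply/eqP; apply: (wnorm_eq0 a0).
have := hK 0 q q' (lexx _) fq fq'.
rewrite -/step eq eq' expr0n/= addr0 mulr0; apply=> i; by rewrite subrr normr0.
Qed.

Lemma step_converges : exists2 l, step l = l & forall q : nat -> 'cV[R]_n,
  feasible (q 0%N) -> (forall t, q t.+1 = step (q t)) -> q @ \oo --> l.
Proof.
(* The lower corner of the box is a convenient feasible start, whose orbit produces the fixed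
   point. *)
pose q0 : 'cV[R]_n := \col_i lo i.
have fq0 : feasible q0 by move=> i; rewrite mxE lexx lohi.
have [l sl _] := @step_trajectory_cvg (fun t => iter t step q0) fq0 (fun=> erefl).
exists l => // q fq qS; have [l' sl' ql'] := step_trajectory_cvg fq qS.
by rewrite (step_fixpoint_unique sl sl').
Qed.

End FixedPoint.

End Convergence.

(** * From the network model to the abstract iteration *)

Section Model.
Context {R : realType}.

Lemma derivative_slope (f : R -> R) (a u v : R) : u <= v -> continuous f ->
  (forall x, u < x < v -> derivable f x 1 /\ `|f^`()%classic x| <= a) ->
  f u - f v <= a * (v - u).
Proof.
rewrite le_eqVlt => /predU1P[->|uv] cf df; first by rewrite !subrr mulr0.
have dfx x : x \in `]u, v[%R -> is_derive x 1 f (f^`()%classic x).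
  by rewrite in_itv => /df[d _]; rewrite derive1E; exact: DeriveDef.
have [x] := MVT uv dfx (continuous_subspaceT cf).
rewrite in_itv => /df[_]; rewrite ler_norml => /andP[h _] e.
have : 0 < v - u by rewrite subr_gt0.
nra.
Qed.

(** Differentiability may fail at the ends of the deadband, so the mean value theorem is used on
    each side separately and the two drops are added across the deadband, where [f] vanishes. *)
Lemma control_slope_bound (f : R -> R) (d a : R) : continuous f ->
  (forall v, - (d / 2) <= v <= d / 2 -> f v = 0) ->
  (forall u v, u <= v -> f v <= f u) ->
  (forall v, outside_deadband d v -> derivable f v 1) ->
  (forall v, outside_deadband d v -> `|f^`()%classic v| <= a) ->
  0 <= d -> 0 < a -> slope_bound a f.
Proof.
move=> cf f0 fni fd fa d0 a0 u v uv; rewrite subr_ge0 fni//=.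
have left x y : x <= y -> y <= - (d / 2) -> f x - f y <= a * (y - x).
  move=> xy yd; apply: derivative_slope => // z /andP[_ zy].
  have z1 : outside_deadband d z by (left; lra).
  by split; [exact: fd|exact: fa].
have right x y : x <= y -> d / 2 <= x -> f x - f y <= a * (y - x).
  move=> xy yd; apply: derivative_slope => // z /andP[zx _].
  have z1 : outside_deadband d z by (right; lra).
  by split; [exact: fd|exact: fa].
have [vd|vd] := leP v (- (d / 2)); first exact: left.
have [ud|ud] := leP (d / 2) u; first exact: right.
(* [f u] and [- f v] are bounded by [a] times the lengths of the parts of [[u, v]] left and right of
   the deadband. *)
have fu : f u <= a * (Num.max (- (d / 2)) u - u).
  have [h|h] := leP u (- (d / 2)).
    by have := left _ _ h (lexx _); rewrite (f0 (- (d / 2))) ?subr0// lexx/=; lra.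
  by rewrite f0 ?subrr ?mulr0//; lra.
have fv : - f v <= a * (v - Num.min (d / 2) v).
  have [h|h] := leP v (d / 2).
    by rewrite f0 ?subrr ?mulr0 ?oppr0//; lra.
  have := right _ _ (ltW h) (lexx _); rewrite (f0 (d / 2)) ?sub0r// lexx andbT; lra.
have : Num.max (- (d / 2)) u <= Num.min (d / 2) v.
  by rewrite ge_max !le_min; repeat (apply/andP; split); lra.
nra.
Qed.

Lemma q_max_ge0 (p s rho : R) : 0 <= p -> 0 <= rho <= pi / 2 -> 0 <= q_max p s rho.
Proof.
move=> p0 /andP[r0 r1]; rewrite /q_max; case: eqP => [_|/eqP rn]; first exact: sqrtr_ge0.
rewrite le_min sqrtr_ge0 andbT mulr_ge0// /tan.
have rp : rho < pi / 2 by rewrite lt_neqAle rn.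
have pi0 := pi_gt0 R.
rewrite divr_ge0//; first by apply: sin_ge0_pi; apply/andP; split; lra.
by apply/ltW/cos_gt0_pihalf; apply/andP; split; lra.
Qed.

(** A singleton becomes a degenerate interval, so one clamp serves both kinds of bus. *)
Lemma Omega_itv n (inv : {set 'I_n}) (p s rho qfix : 'I_n -> R) i :
  Omega inv p s rho qfix i =
  [set q | (if i \in inv then - q_max (p i) (s i) (rho i) else qfix i) <= q <=
           (if i \in inv then q_max (p i) (s i) (rho i) else qfix i)]%classic.
Proof.
rewrite /Omega; case: ifP => // _; apply/seteqP; split=> q /=.
  by move=> ->; rewrite lexx.
by move=> ?; apply/eqP; rewrite eq_le andbC.
Qed.

End Model.

Theorem theorem7 (R : realType) (n : nat)
  (lines : {set {set 'I_n.+1}}) (x : {set 'I_n.+1} -> R)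
  (vtilde : 'cV[R]_n)
  (inv : {set 'I_n}) (p s rho qfix : 'I_n -> R)
  (f : 'I_n -> R -> R) (delta alpha : 'I_n -> R) (gamma : R)
  (tree_lines : is_tree lines)
  (x_gt0 : forall l, l \in lines -> 0 < x l)
  (ps : forall i, i \in inv -> 0 <= p i <= s i)
  (rho_bd : forall i, i \in inv -> 0 <= rho i <= pi / 2)
  (delta_ge0 : forall i, 0 <= delta i)
  (f_cont : forall i, continuous (f i))
  (f_deadband : forall i v, - (delta i / 2) <= v <= delta i / 2 -> f i v = 0)
  (f_noninc : forall i u v, u <= v -> f i v <= f i u)
  (f_decr : forall i u v, outside_deadband (delta i) u ->
     outside_deadband (delta i) v -> u < v -> f i v < f i u)
  (f_diff : forall i v, outside_deadband (delta i) v -> derivable (f i) v 1)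
  (alpha_gt0 : forall i, 0 < alpha i)
  (f_deriv : forall i v,
     outside_deadband (delta i) v \/ inside_deadband (delta i) v ->
     `|(f i)^`()%classic v| <= alpha i)
  (gamma_bd : 0 < gamma <
     2 / (1 + lambda_max (diag_mx (\row_i alpha i) *m reactance_mx lines x))) :
  let X := reactance_mx lines x in
  let Om := Omega inv p s rho qfix in
  exists vstar qstar : 'cV[R]_n,
    [/\ D3_equilibrium X vtilde Om f gamma vstar qstar,
        forall v q : 'cV[R]_n, D3_equilibrium X vtilde Om f gamma v q ->
          v = vstar /\ q = qstar
      & forall v q : nat -> 'cV[R]_n,
          (forall i, Om i (q 0%N i 0)) ->
          D3_trajectory X vtilde Om f gamma v q ->
          (v @ \oo --> vstar)%classic /\ (q @ \oo --> qstar)%classic].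
Proof.
move=> X Om.
have psdX : psd X := reactance_psd x_gt0.
pose lo i := if i \in inv then - q_max (p i) (s i) (rho i) else qfix i.
pose hi i := if i \in inv then q_max (p i) (s i) (rho i) else qfix i.
have lohi i : lo i <= hi i.
  rewrite /lo /hi; case: ifP => // ii; have /andP[p0 _] := ps i ii.
  by have := q_max_ge0 (s i) p0 (rho_bd i ii); lra.
have OmE i : Om i = [set q | lo i <= q <= hi i]%classic by exact: Omega_itv.
(* With the nominal voltage absorbed in [c], the affine map of the abstract iteration is the
   deviation fed to the control functions. *)
pose c : 'cV[R]_n := vtilde - v_nom R n.
have slope_f i : slope_bound (alpha i) (f i).
  apply: (@control_slope_bound _ _ (delta i)) => //.
  - exact: f_deadband.
  - exact: f_noninc.
  - exact: f_diff.
  - by move=> v hv; apply: f_deriv; left.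
have [gamma0] := andP gamma_bd.
set L := lambda_max _ => gammaL.
have [L0 formL] : 0 <= L /\ forall u, dot u (X *m u) <= L * wnorm alpha u.
  exact: lambda_max_form_bound.
have gL : gamma * (1 + L) < 2 by rewrite -ltr_pdivlMr//; lra.
(* The midpoint of [L] and [2 / gamma - 1] keeps the strict stepsize bound and is positive even if
   [L = 0], as the estimates divide by it. *)
pose lam := (L + (2 / gamma - 1)) / 2.
have gL' : L < 2 / gamma - 1.
  by rewrite ltrBrDl ltr_pdivlMr// mulrC.
have lam0 : 0 < lam by rewrite /lam; lra.
have form_lam u : dot u (X *m u) <= lam * wnorm alpha u.
  apply: le_trans (formL u) _; rewrite ler_wpM2r ?wnorm_ge0// /lam; lra.
have gamma_lam : gamma * (1 + lam) < 2.
  have -> : gamma * (1 + lam) = (gamma * (1 + L) + 2) / 2.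
    by rewrite /lam; field; rewrite gt_eqF.
  lra.
have [l sl cvl] := step_converges c alpha_gt0 psdX lohi slope_f lam0 form_lam gamma0 gamma_lam.
have updE q : D3_update Om f gamma (X *m q + vtilde) q = step lo hi X c f gamma q.
  apply/colP => i; rewrite !mxE OmE proj_clamp//.
  by rewrite addrA.
exists (X *m l + vtilde), l; split.
- by split=> //; rewrite updE.
- move=> v q [-> eq]; suff -> : q = l by [].
  apply: (step_fixpoint_unique alpha_gt0 psdX lohi slope_f gamma0 _ sl).
  by rewrite -updE -eq.
move=> v q q0 vq.
have ql : (q @ \oo --> l)%classic.
  apply: cvl => [i|t]; first by have := q0 i; rewrite OmE.
  by have [vt ->] := vq t; rewrite vt updE.
split=> //; apply: (wnorm_cvg alpha_gt0).
(* The norm of [X (q - l)] is a quadratic form in [q - l], hence at most [K] times the norm of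
   [q - l]; the voltages converge with [q]. *)
have [K K0 hK] := form_bounded (X^T *m diag_mx (\row_i (alpha i)^-1) *m X) alpha_gt0.
have h : (K * wnorm alpha (q t - l) @[t --> \oo] --> (0 : R))%classic.
  rewrite -[X in (_ --> X)%classic](mulr0 K); apply: cvgM; first exact: cvg_cst.
  exact: cvg_wnorm.
apply: (squeeze_cvgr _ (cvg_cst 0) h); near=> t; rewrite wnorm_ge0//=.
apply: le_trans (hK _).
have [-> _] := vq t.
by rewrite opprD addrACA subrr addr0 -mulmxBr wnorm_dot -!mulmxA [leRHS]dot_mulmx trmxK.
Unshelve. all: by end_near. Qed.
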